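(* Let $G=(V,E)$ be a loopless connected series-parallel graph, and let $\mathbf v=\{v_e\}_{e\in E}$ be complex numbers with $|1+v_e|<1$ for all $e\in E$. Then $C_G(\mathbf v)\neq 0$, where $$C_G(\mathbf v)=\sum_{A\subseteq E:\ (V,A)\text{ connected}}\ \prod_{e\in A}v_e$$ is the generating polynomial of connected spanning subgraphs of $G$.
   Context: A loopless graph is called series-parallel if it can be obtained from a forest by a finite sequence of series and parallel extensions of edges, i.e. replacing an edge by two edges in series (subdividing it by a new vertex of degree 2) or by two edges in parallel (with the same endpoints). *)

(* Defs.v *)
From mathcomp Require Import all_boot all_order all_algebra.
From mathcomp Require Import reals complex.

Set Implicit Arguments.
Unset Strict Implicit.
Unset Printing Implicit Defensive.

Import GRing.Theory Num.Theory.

(* Finite undirected multigraphs: parallel edges are distinct elements of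
   [edge] with the same endpoint set, and a loop is an edge whose endpoint set
   is a singleton. *)
Record mgraph := MGraph {
  vertex : finType;
  edge : finType;
  ends : edge -> {set vertex};
  endsP : forall e, 0 < #|ends e| <= 2
}.
Arguments ends : clear implicits.

Definition loopless (G : mgraph) : Prop :=
  forall e : edge G, #|ends G e| = 2.

Definition adj (G : mgraph) (A : {set edge G}) : rel (vertex G) :=
  [rel x y | [exists e in A, ends G e == [set x; y]]].

(* Connectedness of the spanning subgraph (V, A). The graph without vertices
   is not connected. *)
Definition spanning_connected (G : mgraph) (A : {set edge G}) : bool :=
  (0 < #|vertex G|) && [forall x, forall y, connect (adj A) x y].

Definition connected (G : mgraph) : Prop := spanning_connected [set: edge G].

(* A cycle of length n+1: distinct vertices v_0, ..., v_n and distinct edges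
   e_0, ..., e_n, where e_i joins v_i and v_(i+1), indices modulo n+1. Loops
   (n = 0) and pairs of parallel edges (n = 1) are cycles. *)
Definition has_cycle (G : mgraph) : Prop :=
  exists (n : nat) (v : 'I_n.+1 -> vertex G) (e : 'I_n.+1 -> edge G),
    [/\ injective v, injective e &
        forall i, ends G (e i) = [set v i; v (ordS i)]].

Definition forest (G : mgraph) : Prop := ~ has_cycle G.

Section Extensions.
Variables (G : mgraph) (e0 : edge G).

Definition par_ends (o : option (edge G)) : {set vertex G} :=
  ends G (odflt e0 o).

Lemma par_endsP o : 0 < #|par_ends o| <= 2.
Proof. exact: endsP. Qed.

(* [Some e0] and [None] are the two edges replacing [e0]. *)
Definition par_ext : mgraph := MGraph par_endsP.

Variables (x y : vertex G).

Definition ser_ends (o : option (edge G)) : {set option (vertex G)} :=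
  match o with
  | Some f => if f == e0 then [set Some x; None] else Some @: ends G f
  | None => [set None; Some y]
  end.

Lemma ser_endsP o : 0 < #|ser_ends o| <= 2.
Proof.
case: o => [f|] /=; last by rewrite cards2.
case: ifP => _; first by rewrite cards2.
by rewrite card_imset ?endsP //; exact: Some_inj.
Qed.

(* For [e0] with endpoints [x] and [y]: the new vertex is [None], and [Some e0]
   (joining [x] to it) and [None] (joining it to [y]) replace [e0]. *)
Definition ser_ext : mgraph := MGraph ser_endsP.

End Extensions.

Definition isomorphic (G H : mgraph) : Prop :=
  exists (f : vertex G -> vertex H) (g : edge G -> edge H),
    [/\ bijective f, bijective g & forall e, ends H (g e) = f @: ends G e].

Inductive series_parallel : mgraph -> Prop :=
| SP_forest G : forest G -> series_parallel G
| SP_series G (e : edge G) (x y : vertex G) :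
    ends G e = [set x; y] ->
    series_parallel G -> series_parallel (ser_ext e x y)
| SP_parallel G (e : edge G) :
    series_parallel G -> series_parallel (par_ext e)
| SP_iso G H : isomorphic G H -> series_parallel G -> series_parallel H.

Local Open Scope ring_scope.

Definition conn_poly (R : realType) (G : mgraph) (v : edge G -> R[i]) : R[i] :=
  \sum_(A : {set edge G} | spanning_connected A) \prod_(e in A) v e.

(* Main.v *)
(** The formulas behind the induction are [C(v1,v2) = C(v1 + v2 + v1 v2)] for a
    parallel extension and [C(v1,v2) = (v1 + v2) C(v1 v2 / (v1 + v2))] for a
    series extension.  The disc [|1 + v| < 1] is stable under both operations:
    the first one multiplies the numbers [1 + v], the second one adds the
    inverses [1 / v], and the disc is the set of the [v] such that
    [2 Re (1 / v) < - 1].  For a tree the polynomial is the product of the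
    weights, which are nonzero. *)
Require Import Defs.
From mathcomp Require Import all_boot all_order all_algebra.
From mathcomp Require Import reals complex.
From mathcomp Require Import ring zify.

Set Implicit Arguments.
Unset Strict Implicit.
Unset Printing Implicit Defensive.

Import Order.TTheory GRing.Theory Num.Theory.
Local Open Scope ring_scope.

(** * The disc of weights and its two stability properties *)

(** For nonzero [v], [|1 + v|^2 - 1] equals [|v|^2] times the right-hand quantity. Inversion thus
    turns the disc into a half-plane. *)
Lemma disc_inv (C : numClosedFieldType) (v : C) :
  (`|1 + v| < 1) = (v != 0) && (v^-1 + (v^-1)^* + 1 < 0).
Proof.
have [->|v0] /= := eqVneq v 0; first by rewrite addr0 normr1 ltxx.
have w0 : v^* != 0 by rewrite conjC_eq0.
have vw0 : 0 < v * v^* by rewrite -normCK exprn_gt0 // normr_gt0.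
rewrite -(expr_lt1 (n := 2)) // normCK rmorphD rmorph1 fmorphV.
rewrite -(pmulr_llt0 _ vw0) -subr_lt0; congr (_ < 0).
by field; rewrite v0 w0.
Qed.

Lemma disc_parallel (C : numClosedFieldType) (v w : C) :
  `|1 + v| < 1 -> `|1 + w| < 1 -> `|1 + (v + w + v * w)| < 1.
Proof.
move=> hv hw; have -> : 1 + (v + w + v * w) = (1 + v) * (1 + w) by ring.
by rewrite normrM mulr_ilt1.
Qed.

(** If [w = - v], the inverses cancel and the two negative quantities of [disc_inv] add up to 2. *)
Lemma disc_add_neq0 (C : numClosedFieldType) (v w : C) :
  `|1 + v| < 1 -> `|1 + w| < 1 -> v + w != 0.
Proof.
rewrite !disc_inv => /andP[_ hv] /andP[_ hw]; apply/negP => /eqP /addr0_eq vw.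
have := ltrD hv hw; rewrite -vw invrN rmorphN addr0.
have -> : v^-1 + (v^-1)^* + 1 + (- v^-1 - (v^-1)^* + 1) = 2%:R by ring.
by rewrite ltrn0.
Qed.

Lemma disc_series (C : numClosedFieldType) (v w : C) :
  `|1 + v| < 1 -> `|1 + w| < 1 -> `|1 + v * w / (v + w)| < 1.
Proof.
move=> hv hw; have vw0 := disc_add_neq0 hv hw.
move: hv hw; rewrite !disc_inv => /andP[v0 hv] /andP[w0 hw].
rewrite !mulf_neq0 ?invr_eq0 //=.
have -> : (v * w / (v + w))^-1 = v^-1 + w^-1 by field; rewrite v0 w0 vw0.
(* The two half-plane inequalities add up with constant term 2, while the goal has constant term
   1. *)
rewrite rmorphD /=; have := ltrD hv hw; rewrite addr0; apply: lt_trans.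
rewrite -subr_gt0.
set s := (X in 0 < X); have -> : s = 1 by rewrite /s; ring.
exact: ltr01.
Qed.

(** * Splitting sums over edge sets *)

Lemma big_set_option (V : nmodType) (T : finType) (F : {set option T} -> V) :
  \sum_A F A = \sum_(B : {set T}) (F (Some @: B) + F (None |: Some @: B)).
Proof.
have noneS (B : {set T}) : (None \in Some @: B) = false.
  by apply/imsetP => -[].
rewrite (bigID (fun A : {set option T} => None \in A)) /= addrC big_split /=.
congr (_ + _).
- rewrite (reindex_onto (fun B : {set T} => Some @: B)
     (fun A => [set b | Some b \in A])) /=.
    apply: eq_bigl => B; rewrite noneS /=; apply/eqP/setP => b.
    by rewrite inE mem_imset //; exact: Some_inj.
  move=> A nA; apply/setP => -[b|]; last by rewrite noneS (negbTE nA).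
  by rewrite mem_imset ?inE //; exact: Some_inj.
- rewrite (reindex_onto (fun B : {set T} => None |: Some @: B)
     (fun A => [set b | Some b \in A])) /=.
    apply: eq_bigl => B; rewrite setU11 /=; apply/eqP/setP => b.
    by rewrite !inE /= mem_imset //; exact: Some_inj.
  move=> A nA; apply/setP => -[b|]; last by rewrite setU11 nA.
  by rewrite !inE /= mem_imset ?inE //; exact: Some_inj.
Qed.

(** After [big_set_option], this groups the edge sets of an extension of [e] by their trace [B] away
    from [e], four sets for each [B]. *)
Lemma big_set_split (V : nmodType) (T : finType) (e : T) (F : {set T} -> V) :
  \sum_A F A = \sum_(B : {set T} | e \notin B) (F B + F (e |: B)).
Proof.
rewrite (bigID (fun A : {set T} => e \in A)) /= addrC big_split /=.
congr (_ + _).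
rewrite (reindex_onto (fun B => e |: B) (fun A => A :\ e)) /=; last first.
  by move=> A eA; rewrite setD1K.
apply: eq_bigl => B; rewrite setU11 /=; apply/eqP/idP => [<-|eB].
  by rewrite setD11.
by rewrite setU1K.
Qed.

(** * Connectedness under extensions *)

Lemma adj_sym (G : mgraph) (A : {set edge G}) : symmetric (adj A).
Proof. by move=> x y; rewrite /adj /= setUC. Qed.

Lemma connect_adj_sym (G : mgraph) (A : {set edge G}) :
  connect_sym (adj A).
Proof. exact/sym_connect_sym/adj_sym. Qed.

Lemma connect_ends (G : mgraph) (A : {set edge G}) (e : edge G) x y :
  e \in A -> x \in ends G e -> y \in ends G e -> connect (adj A) x y.
Proof.
move=> eA xe ye; have [->|xy] := eqVneq x y; first exact: connect0.
apply: connect1; apply/existsP; exists e; rewrite eA eq_sym eqEcard.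
by rewrite subUset !sub1set xe ye cards2 xy; case/andP: (endsP e).
Qed.

(** An [A]-path is transported edge by edge, and every vertex of [H] is linked to the image of [f].
    Each equivalence of connectedness below is two uses of this. *)
Lemma spanning_connected_map (G H : mgraph) (A : {set edge G})
    (B : {set edge H}) (f : vertex G -> vertex H) :
  (forall e x y, e \in A -> x \in ends G e -> y \in ends G e ->
     connect (adj B) (f x) (f y)) ->
  (forall z, exists x, connect (adj B) z (f x)) ->
  spanning_connected A -> spanning_connected B.
Proof.
move=> fA fH /andP[/card_gt0P[x0 _] /forallP conA]; apply/andP; split.
  by apply/card_gt0P; exists (f x0).
apply/forallP => z; apply/forallP => t.
have [x zx] := fH z; have [y ty] := fH t.
apply: connect_trans zx _; rewrite connect_adj_sym in ty.
apply: connect_trans ty; have /forallP/(_ y)/connectP[p] := conA x.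
elim: p x => [|x' p IHp] x /=; first by move=> _ ->; exact: connect0.
move=> /andP[/existsP[e /andP[eA /eqP ee]] px' yx'].
apply: connect_trans (IHp _ px' yx').
by apply: (fA e); rewrite ?ee ?set21 ?set22.
Qed.

(** Both copies of [e] have the same ends, so merging them by [odflt e] keeps reachability. *)
Lemma spanning_connected_par (G : mgraph) (e : edge G)
    (A : {set edge (par_ext e)}) :
  spanning_connected A = spanning_connected (odflt e @: A).
Proof.
pose PE := par_ext e.
apply/idP/idP.
- apply: (@spanning_connected_map PE G A _ id).
    move=> o x y oA xo yo; apply: (connect_ends (e := odflt e o)) => //.
    exact: imset_f.
  by move=> z; exists z; exact: connect0.
- apply: (@spanning_connected_map G PE _ A id).
    by move=> f x y /imsetP[o oA ->] xo yo; exact: (@connect_ends PE A o).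
  by move=> z; exists z; exact: connect0.
Qed.

Lemma odflt_Some_imset (T : finType) (e : T) (B : {set T}) :
  odflt e @: (Some @: B) = B.
Proof. by rewrite -imset_comp (eq_imset _ (g := id)) ?imset_id. Qed.

Section Series.
Variables (G : mgraph) (e : edge G) (x y : vertex G).
Hypothesis exy : ends G e = [set x; y].
Variable B : {set edge G}.
Hypothesis eB : e \notin B.

Let SE := ser_ext e x y.
(** Contracts one half of [e]: [Some e] for [z0 = x], [None] for [z0 = y]. *)
Let proj (z0 : vertex G) (o : vertex SE) : vertex G := odflt z0 o.

Lemma ser_connect_Some (A : {set edge SE}) f a b : f \in B ->
  Some f \in A -> a \in ends G f -> b \in ends G f ->
  connect (adj A) (Some a : vertex SE) (Some b).
Proof.
move=> fB fA af bf; apply: (connect_ends (e := (Some f : edge SE))) => //=;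
  have /negbTE-> : f != e by apply: contraNneq eB => <-.
all: exact: imset_f.
Qed.

Lemma ser_proj_connect (A : {set edge G}) z0 f a b :
  B \subset A -> f \in B -> a \in ends SE (Some f) -> b \in ends SE (Some f) ->
  connect (adj A) (proj z0 a) (proj z0 b).
Proof.
move=> BA fB /=; have /negbTE-> : f != e by apply: contraNneq eB => <-.
move=> /imsetP[a' af ->] /imsetP[b' bf ->] /=.
by apply: connect_ends af bf; exact: (subsetP BA).
Qed.

(** With neither half of [e] present, the new vertex is isolated. *)
Lemma spanning_connected_ser0 :
  ~~ spanning_connected (Some @: B : {set edge SE}).
Proof.
apply/negP => /andP[_ /forallP/(_ None)/forallP/(_ (Some x))/connectP[[//|z p]]].
move=> /= /andP[/existsP[o /andP[/imsetP[f fB ->] E]] _ _].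
have /negbTE fe : f != e by apply: contraNneq eB => <-.
move: E; rewrite /= fe => /eqP E.
have : None \in [set None; z] by rewrite set21.
by rewrite -E => /imsetP[].
Qed.

(** The new vertex hangs from [x] by a single edge, which [proj x] contracts. *)
Lemma spanning_connected_ser1 :
  spanning_connected (Some @: (e |: B) : {set edge SE}) = spanning_connected B.
Proof.
apply/idP/idP.
- apply: (@spanning_connected_map SE G _ _ (proj x)); last first.
    by move=> z; exists (Some z); exact: connect0.
  move=> o a b /imsetP[f /setU1P[->|fB] ->]; last exact: ser_proj_connect.
  by rewrite /= eqxx => /set2P[]-> /set2P[]-> /=; exact: connect0.
- apply: (@spanning_connected_map G SE _ _ Some).
    move=> f a b fB; apply: ser_connect_Some => //.
    by rewrite imset_f // setU1r.
  case=> [z|]; first by exists z; exact: connect0.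
  exists x; apply: (connect_ends (e := (Some e : edge SE))) => /=.
  + by rewrite imset_f // setU11.
  + by rewrite eqxx set22.
  + by rewrite eqxx set21.
Qed.

Lemma spanning_connected_ser2 :
  spanning_connected (None |: Some @: B : {set edge SE}) = spanning_connected B.
Proof.
apply/idP/idP.
- apply: (@spanning_connected_map SE G _ _ (proj y)); last first.
    by move=> z; exists (Some z); exact: connect0.
  move=> o a b /setU1P[->|/imsetP[f fB ->]]; last exact: ser_proj_connect.
  by move=> /= /set2P[]-> /set2P[]-> /=; exact: connect0.
- apply: (@spanning_connected_map G SE _ _ Some).
    move=> f a b fB; apply: ser_connect_Some => //.
    by rewrite setU1r // imset_f.
  case=> [z|]; first by exists z; exact: connect0.
  exists y; apply: (connect_ends (e := (None : edge SE))) => /=.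
  + by rewrite setU11.
  + by rewrite set21.
  + by rewrite set22.
Qed.

Lemma spanning_connected_ser12 :
  spanning_connected (None |: Some @: (e |: B) : {set edge SE})
  = spanning_connected (e |: B).
Proof.
set A : {set edge SE} := None |: _.
have eA : Some e \in A by rewrite setU1r // imset_f // setU11.
apply/idP/idP.
- apply: (@spanning_connected_map SE G _ _ (proj x)); last first.
    by move=> z; exists (Some z); exact: connect0.
  move=> o a b /setU1P[->|/imsetP[f /setU1P[->|fB] ->]].
  (* Under [proj x] the half [None] becomes a link from [x] to [y], provided by [e] itself. *)
  + by move=> /= /set2P[]-> /set2P[]-> /=; apply: (connect_ends (e := e));
      rewrite ?setU11 // exy ?set21 ?set22.
  + by rewrite /= eqxx => /set2P[]-> /set2P[]-> /=; exact: connect0.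
  + by apply: ser_proj_connect => //; exact: subsetUr.
- apply: (@spanning_connected_map G SE _ _ Some).
    have xN : connect (@adj SE A) (Some x : vertex SE) None.
      by apply: (connect_ends (e := (Some e : edge SE)));
        rewrite //= eqxx ?set21 ?set22.
    have Ny : connect (@adj SE A) (None : vertex SE) (Some y).
      by apply: (connect_ends (e := (None : edge SE)));
        rewrite /= ?setU11 ?set21 ?set22.
    have xy := connect_trans xN Ny.
    move=> f a b /setU1P[->|fB].
      rewrite exy => /set2P[]-> /set2P[]-> //; try exact: connect0.
      by rewrite connect_adj_sym.
    by apply: ser_connect_Some => //; rewrite setU1r // imset_f // setU1r.
  case=> [z|]; first by exists z; exact: connect0.
  exists x; apply: (connect_ends (e := (Some e : edge SE))) => //=.
  + by rewrite eqxx set22.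
  + by rewrite eqxx set21.
Qed.

End Series.

(** * Reduction formulas for the polynomial *)

Section Polynomial.
Variable R : realType.

Lemma prod_Some (T : finType) (v : option T -> R[i]) (B : {set T}) :
  \prod_(o in Some @: B) v o = \prod_(f in B) v (Some f).
Proof. by rewrite big_imset //= => a b _ _ []. Qed.

Lemma prod_None_Some (T : finType) (v : option T -> R[i]) (B : {set T}) :
  \prod_(o in None |: Some @: B) v o = v None * \prod_(f in B) v (Some f).
Proof. by rewrite big_setU1 ?prod_Some //; apply/imsetP => -[]. Qed.

(** Isolates the weight of [e], so that the reduction formulas can be checked separately for each
    [B]. *)
Lemma conn_poly_split (G : mgraph) (e : edge G) (v : edge G -> R[i]) :
  conn_poly v = \sum_(B : {set edge G} | e \notin B)
    ((spanning_connected B)%:R + (spanning_connected (e |: B))%:R * v e)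
    * \prod_(f in B) v f.
Proof.
rewrite /conn_poly big_mkcond (big_set_split e) /=; apply: eq_bigr => B eB.
rewrite big_setU1 //=.
by case: (spanning_connected _); case: (spanning_connected _) => /=; ring.
Qed.

Definition subst_weight (T : eqType) (e : T) (w : R[i]) (v : option T -> R[i])
  (f : T) : R[i] := if f == e then w else v (Some f).

Lemma prod_subst_weight (T : finType) (e : T) w v (B : {set T}) : e \notin B ->
  \prod_(f in B) subst_weight e w v f = \prod_(f in B) v (Some f).
Proof.
move=> eB; apply: eq_bigr => f fB; rewrite /subst_weight ifN //.
by apply: contraNneq eB => <-.
Qed.

(** The three nonempty choices among the two copies all act as [e] and contribute [v1], [v2] and
    [v1 * v2]. *)
Lemma conn_poly_par (G : mgraph) (e : edge G) (v : edge (par_ext e) -> R[i]) :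
  let v1 := v (Some e) in let v2 := v None in
  conn_poly v = conn_poly (subst_weight e (v1 + v2 + v1 * v2) v).
Proof.
move=> v1 v2; rewrite (conn_poly_split e) /conn_poly big_mkcond.
rewrite big_set_option (big_set_split e) /=; apply: eq_bigr => B eB.
rewrite !prod_None_Some !prod_Some !big_setU1 //= prod_subst_weight //.
rewrite /subst_weight eqxx !spanning_connected_par !imsetU !imset_set1 /=.
rewrite !odflt_Some_imset setUA setUid -/v1 -/v2.
by case: (spanning_connected _); case: (spanning_connected _) => /=; ring.
Qed.

(** For each [B], taking no half gives 0, exactly one half acts as deleting [e] with total weight
    [v1 + v2], and both act as keeping [e] with weight [v1 * v2]. Factoring out [v1 + v2] leaves the
    effective weight of [e]. *)
Lemma conn_poly_ser (G : mgraph) (e : edge G) (x y : vertex G)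
    (v : edge (ser_ext e x y) -> R[i]) :
  let v1 := v (Some e) in let v2 := v None in
  ends G e = [set x; y] -> v1 + v2 != 0 ->
  conn_poly v =
    (v1 + v2) * conn_poly (subst_weight e (v1 * v2 / (v1 + v2)) v).
Proof.
move=> v1 v2 exy v0; rewrite (conn_poly_split e) /conn_poly big_mkcond.
rewrite big_set_option (big_set_split e) mulr_sumr /=.
apply: eq_bigr => B eB.
rewrite !prod_None_Some !prod_Some !big_setU1 //= prod_subst_weight //.
rewrite /subst_weight eqxx (negbTE (spanning_connected_ser0 _ _ eB)).
rewrite spanning_connected_ser1 // spanning_connected_ser2 //.
rewrite spanning_connected_ser12 // -/v1 -/v2.
by case: (spanning_connected _); case: (spanning_connected _) => /=; field.
Qed.

End Polynomial.

(** * Connectedness of smaller graphs, isomorphisms and forests *)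

Lemma spanning_connectedT (G : mgraph) (A : {set edge G}) :
  spanning_connected A -> connected G.
Proof.
apply: (@spanning_connected_map G G _ _ id).
  by move=> e x y _; exact: connect_ends.
by move=> z; exists z; exact: connect0.
Qed.

Lemma connected_par (G : mgraph) (e : edge G) :
  connected (par_ext e) -> connected G.
Proof.
by rewrite /connected spanning_connected_par; exact: spanning_connectedT.
Qed.

Lemma connected_ser (G : mgraph) (e : edge G) (x y : vertex G) :
  ends G e = [set x; y] -> connected (ser_ext e x y) -> connected G.
Proof.
(* Taking [B] to be the complement of [e] makes the edge set in [spanning_connected_ser12] the full
   one. *)
move=> exy cS; apply: (@spanning_connectedT _ (e |: [set~ e])).
have eC : e \notin [set~ e] by rewrite !inE eqxx.
move: (spanning_connected_ser12 exy eC) => <-.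
rewrite (_ : None |: _ = [set: edge (ser_ext e x y)]) //.
apply/setP => -[f|]; rewrite !inE //= mem_imset ?inE ?orbN //.
exact: Some_inj.
Qed.

Lemma spanning_connected_iso (G H : mgraph) (f : vertex G -> vertex H)
    (g : edge G -> edge H) :
  bijective f -> injective g -> (forall e, ends H (g e) = f @: ends G e) ->
  forall A : {set edge G},
  spanning_connected (g @: A) = spanning_connected A.
Proof.
move=> [f' fK f'K] gI gE A; apply/idP/idP.
- apply: (@spanning_connected_map H G _ _ f').
    move=> h x y /imsetP[e eA ->]; rewrite gE.
    move=> /imsetP[x' xe ->] /imsetP[y' ye ->]; rewrite !fK.
    exact: connect_ends eA xe ye.
  by move=> z; exists (f z); rewrite fK connect0.
- apply: (@spanning_connected_map G H _ _ f).
    move=> e x y eA xe ye.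
    by apply: (connect_ends (e := g e)); rewrite ?gE imset_f.
  by move=> z; exists (f' z); rewrite f'K connect0.
Qed.

Lemma conn_poly_iso (R : realType) (G H : mgraph) (f : vertex G -> vertex H)
    (g : edge G -> edge H) (v : edge H -> R[i]) :
  bijective f -> bijective g -> (forall e, ends H (g e) = f @: ends G e) ->
  conn_poly v = conn_poly (v \o g).
Proof.
move=> fB [g' gK g'K] gE; have gI := can_inj gK.
rewrite /conn_poly (reindex (fun A : {set edge G} => g @: A)) /=; last first.
  exists (fun A : {set edge H} => g' @: A) => A _; rewrite -imset_comp.
    by rewrite (eq_imset _ (g := id)) ?imset_id.
  by rewrite (eq_imset _ (g := id)) ?imset_id.
apply: eq_big => A; first exact: (spanning_connected_iso fB gI gE).
by move=> _; rewrite big_imset //= => a b _ _ /gI.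
Qed.

(* An edge outside [A] closes a simple [A]-path between its ends into a cycle;
   the edges of the path differ from it because they lie in [A]. *)
Lemma spanning_connected_forest (G : mgraph) (A : {set edge G}) :
  forest G -> spanning_connected A -> A = [set: edge G].
Proof.
move=> fG /andP[_ /forallP conA]; apply/setP => e; rewrite inE.
apply/negbNE/negP => eA; apply: fG.
(* A loop gives [x = y]; the simple path is then empty and the cycle has the single edge [e]. *)
have [x [y exy]] : exists x y, ends G e = [set x; y].
  have /andP[] := endsP e; case E: #|ends G e| => [|[|[|k]]] // _ _.
    by have /eqP/cards1P[x ->] := E; exists x, x; rewrite setUid.
  by have /eqP/cards2P[x [y [_ ->]]] := E; exists x, y.
have /forallP/(_ y)/connectP[p0 pA0 yp0] := conA x.
case/shortenP: pA0 yp0 => p pA pU _ yp {p0}.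
pose joins (i : nat) (a : edge G) :=
  ends G a == [set nth x (x :: p) i; nth x (x :: p) i.+1].
(* Indices below [size p] follow the path and the last one is [e]. The default of [odflt] is never
   reached, since each step of the path has an edge in [A]. *)
pose ed (i : 'I_(size p).+1) : edge G :=
  if (i < size p)%N then odflt e [pick a in A | joins i a] else e.
have edP (i : 'I_(size p).+1) : (i < size p)%N ->
    (ed i \in A) && joins i (ed i).
  rewrite /ed => ip; rewrite ip; case: pickP => //= noa.
  have /(pathP x)/(_ i ip)/existsP[a] := pA.
  by move=> ha; have := noa a; rewrite /joins /= ha.
have edA (i : 'I_(size p).+1) : (ed i \in A) = (i < size p)%N.
  case ip: (i < size p)%N; first by have /andP[] := edP i ip.
  by rewrite /ed ip (negbTE eA).
have edN (i : 'I_(size p).+1) : (i < size p)%N = false -> i = size p :> nat.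
  by move/negbT; rewrite -leqNgt => h; apply/eqP; rewrite eqn_leq h -ltnS andbT.
have nthI i j : (i < size (x :: p))%N -> (j < size (x :: p))%N ->
    nth x (x :: p) i = nth x (x :: p) j -> i = j.
  by move=> ip jp /eqP; rewrite nth_uniq // => /eqP.
exists (size p), (fun i => nth x (x :: p) i), ed; split.
- by move=> i j /nthI ij; apply/val_inj/ij; exact: ltn_ord.
- move=> i j ij; apply: ord_inj; have := edA i; rewrite ij edA.
  case ip: (i < size p)%N => jp; last by rewrite (edN i ip) (edN j jp).
  have /andP[_ /eqP Ei] := edP i ip; have /andP[_ /eqP Ej] := edP j jp.
  (* The [k]-th path edge meets only the path vertices [k] and [k + 1]. Equal edges at [i] and [j]
     thus place each index at most one above the other and never below it, so [i = j]. *)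
  have next (k l : 'I_(size p).+1) : (k < size p)%N ->
      ends G (ed k) = [set nth x (x :: p) k; nth x (x :: p) k.+1] ->
      nth x (x :: p) l \in ends G (ed k) -> l = k :> nat \/ l = k.+1 :> nat.
    move=> kp -> /set2P[] /nthI h; [left|right]; apply: h => //;
      exact: ltn_ord.
  have ji := next i j ip Ei; have ij' := next j i jp Ej.
  rewrite ij Ej set21 in ji; rewrite -ij Ei set21 in ij'.
  by have := ji isT; have := ij' isT; lia.
- move=> i; case ip: (i < size p)%N.
    have /andP[_ /eqP ->] := edP i ip.
    by rewrite /= modn_small // ltnS.
  (* At the last index [ordS] wraps around to 0, and [e] joins the end [y] of the path to its start
     [x]. *)
  by rewrite /ed ip /= (edN i ip) modnn (nth_last x (x :: p)) /= -yp exy setUC.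
Qed.

(** * Induction on the series-parallel construction *)

(** The weights are quantified inside the induction, because each reduction replaces them by those
    of [subst_weight]. *)
Lemma series_parallel_conn_poly_neq0 (R : realType) (G : mgraph) :
  series_parallel G -> connected G ->
  forall v : edge G -> R[i], (forall e, `|1 + v e| < 1) -> conn_poly v != 0.
Proof.
elim=> {G} [G fG|G e x y exy _ IH|G e _ IH|G H [f [g [fB gB gE]]] _ IH] cG v hv.
(* In a connected forest only the full edge set contributes, so the sum is a single product of
   nonzero weights. *)
- rewrite /conn_poly (big_pred1 [set: edge G]) => [|A]; last first.
    by apply/idP/eqP => [/(spanning_connected_forest fG)|->].
  apply/prodf_neq0 => e _; have := hv e.
  by rewrite disc_inv => /andP[].
- have v0 := disc_add_neq0 (hv (Some e)) (hv None).
  rewrite conn_poly_ser // mulf_neq0 // IH //; first exact: connected_ser cG.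
  by move=> f; rewrite /subst_weight; case: ifP => // _; exact: disc_series.
- rewrite conn_poly_par; apply: IH; first exact: connected_par cG.
  by move=> f; rewrite /subst_weight; case: ifP => // _; exact: disc_parallel.
- rewrite (conn_poly_iso v fB gB gE); apply: IH => [|e /=]; last exact: hv.
  have [g' _ g'K] := gB.
  rewrite /connected -(spanning_connected_iso fB (bij_inj gB) gE).
  have -> // : g @: setT = setT.
  by apply/setP => h; rewrite inE -[h]g'K imset_f.
Qed.

Theorem theorem7p1 (R : realType) (G : mgraph) (v : edge G -> R[i]) :
  loopless G -> connected G -> series_parallel G ->
  (forall e : edge G, `|1 + v e| < 1) ->
  conn_poly v <> 0.
Proof.
by move=> _ cG spG hv; apply/eqP; exact: series_parallel_conn_poly_neq0.
Qed.
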